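(* Let $V$ be a capacity on $(\Omega,\mathcal F)$ and let $X_1,X_2$ be real random variables on $(\Omega,\mathcal F)$ that are Fubini independent for $\mathcal B^2$. Then: (I) $X_1$ and $X_2$ are Fubini independent for $\mathcal U_f$, for every Borel measurable $f:\mathbb R^2\to\mathbb R$, and Fubini independent for $\mathcal R$; (II) for all Borel sets $A,B\subseteq\mathbb R$, $$V(X_1\in A,\ X_2\in B)=V(X_1\in A)\,V(X_2\in B).$$
   Context: $(\Omega,\mathcal F)$ is a measurable space. A capacity is a set function $V:\mathcal F\to[0,1]$ with $V(\emptyset)=0$, $V(\Omega)=1$, and $V(A)\le V(B)$ whenever $A\subseteq B$, $A,B\in\mathcal F$. A random variable is an $\mathcal F$-measurable map $\Omega\to\mathbb R$. The Choquet integral of a bounded random variable $X$ is $$E_V[X]=\int_0^{+\infty}V(\{X\ge t\})\,dt+\int_{-\infty}^0\big[V(\{X\ge t\})-1\big]\,dt.$$ $\mathcal B^2$ is the Borel $\sigma$-algebra of $\mathbb R^2$; $\mathcal R$ is the family of rectangles $A\times B$ with $A,B$ Borel subsets of $\mathbb R$; for $f:\mathbb R^2\to\mathbb R$, $\mathcal U_f=\{\{(x_1,x_2)\in\mathbb R^2: f(x_1,x_2)>\alpha\}:\alpha\in\mathbb R\}$. For a family $\mathcal C\subseteq\mathcal B^2$ (here $\mathcal C=\mathcal B^2$, $\mathcal U_f$ or $\mathcal R$), $X_1$ and $X_2$ are Fubini independent for $\mathcal C$ (i.e. $X_2$ is Fubini independent of $X_1$ for $\mathcal C$) if for every $A\in\mathcal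 C$ $$V((X_1,X_2)\in A)=E_V\big[V((x_1,X_2)\in A)|_{x_1=X_1}\big],$$ where $V((x_1,X_2)\in A)|_{x_1=X_1}$ denotes the function $\omega\mapsto h(X_1(\omega))$ with $h(x_1)=V(\{\omega':(x_1,X_2(\omega'))\in A\})$; this function is understood to be $\mathcal F$-measurable as part of the definition. *)

(* Defs.v *)
From HB Require Import structures.
From mathcomp Require Import all_boot all_order all_algebra.
From mathcomp Require Import all_classical all_reals all_analysis.

Set Implicit Arguments.
Unset Strict Implicit.
Unset Printing Implicit Defensive.

Import Order.TTheory GRing.Theory Num.Theory.
Import numFieldNormedType.Exports.

Local Open Scope classical_set_scope.
Local Open Scope ring_scope.

(* A capacity lives on the measurable sets only: [V] is total for convenience,
   and its values on non-measurable sets are left unconstrained. *)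
Record is_capacity (d : measure_display) (T : measurableType d) (R : realType)
    (V : set T -> R) : Prop := IsCapacity {
  capacity_itv : forall A, measurable A -> 0 <= V A <= 1 ;
  capacity_set0 : V set0 = 0 ;
  capacity_setT : V setT = 1 ;
  capacity_le : forall A B, measurable A -> measurable B ->
    A `<=` B -> V A <= V B
}.

(* For a bounded random variable both integrands are monotone with bounded
   support, so the value is a finite extended real. *)
Definition choquet (d : measure_display) (T : measurableType d) (R : realType)
    (V : set T -> R) (X : T -> R) : \bar R :=
  (\int[lebesgue_measure]_(t in `[0%R, +oo[) (V [set w | t <= X w]%R)%:E
   + \int[lebesgue_measure]_(t in `]-oo, 0%R])
       (V [set w | t <= X w]%R - 1)%:E)%E.

Definition borelR2 (R : realType) : measurableType _ :=
  g_sigma_algebraType (@open (R * R)%type).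

Definition rectangles (R : realType) : set (set (R * R)) :=
  [set C | exists A B : set R, [/\ measurable A, measurable B & C = A `*` B]].

Definition upper_level_sets (R : realType) (f : R * R -> R) :
    set (set (R * R)) :=
  [set C | exists alpha : R, C = [set x | alpha < f x]].

(* [X2] is Fubini independent of [X1] for [C]; not symmetric in [X1], [X2]. *)
Definition fubini_independent (d : measure_display) (T : measurableType d)
    (R : realType) (V : set T -> R) (X1 X2 : T -> R)
    (C : set (set (R * R))) : Prop :=
  forall A, C A ->
    let h x1 := V [set w | A (x1, X2 w)] in
    measurable_fun setT (h \o X1) /\
    (V [set w | A (X1 w, X2 w)])%:E = choquet V (h \o X1).

(* Main.v *)
(* For fixed x1, the section of A * B at x1 is B or empty according as x1 lies
   in A or not, so h o X1 is v times the indicator of {X1 in A} with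
   v = V(X2 in B).  Its upper level sets are {X1 in A} for 0 < t <= v and empty
   for t > v, hence its Choquet integral is V(X1 in A) * v. *)
Require Import Defs.
From mathcomp Require Import all_boot all_order all_algebra.
From mathcomp Require Import all_classical all_reals all_analysis.
From mathcomp Require Import measurable_realfun.
Import Order.TTheory GRing.Theory Num.Theory.
Import numFieldNormedType.Exports.
Local Open Scope classical_set_scope.
Local Open Scope ring_scope.

(* [borelR2] is generated by the open sets of the plane, not as a product, so the
   library's measurability of [fst] and [snd] does not apply; continuity does. *)
Lemma continuous_borelR2_measurable (R : realType) (g : R * R -> R) :
  continuous g -> measurable_fun setT (g : borelR2 R -> R).
Proof.
move=> /continuousP cg; apply: (measurability _ (RGenOpens.measurableE R)).
move=> _ [_ [x [y ->] <-]]; rewrite setTI.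
by apply: sub_sigma_algebra; apply: cg; exact: interval_open.
Qed.

(** A rectangle is the intersection of two cylinders, preimages of Borel sets under the continuous
    projections. *)
Lemma measurable_rectangles (R : realType) :
  @rectangles R `<=` @measurable _ (borelR2 R).
Proof.
move=> _ [A [B [mA mB ->]]].
have -> : A `*` B = (fst @^-1` A) `&` (snd @^-1` B) by [].
apply: measurableI; rewrite -[X in measurable X]setTI.
  by apply: (@continuous_borelR2_measurable R fst) => // x; exact: cvg_fst.
by apply: (@continuous_borelR2_measurable R snd) => // x; exact: cvg_snd.
Qed.

Lemma choquet_scaled_indic (d : measure_display) (T : measurableType d)
    (R : realType) (V : set T -> R) (D : set T) (v : R) :
  V set0 = 0 -> V setT = 1 -> 0 <= v ->
  choquet V (fun w => v * \1_D w) = (V D * v)%:E.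
Proof.
move=> V0 V1 v0; rewrite /choquet.
pose f (t : R) := (V [set w | t <= v * \1_D w])%:E.
(* The interval is open at 0: there the level set is the whole space, so [f 0] is 1, in general not
   [V D]. *)
pose g : R -> \bar R := cst (V D)%:E \_ `]0, v]%classic.
have fg : {in `]0, +oo[%classic, g =1 f}.
  move=> t; rewrite inE/= in_itv/= andbT /f /g patchE => t0.
  apply/esym; rewrite mem_setE in_itv/= t0/=; case: ifPn => tv /=.
    congr (V _)%:E; apply/seteqP; split=> w /=; rewrite indicE.
      have [/set_mem//|_] := boolP (w \in D).
      by rewrite mulr0 leNgt t0.
    by move=> /mem_set ->; rewrite mulr1.
  (* For [t > v] the level set is empty; 0 is written as [V set0] so that only sets are compared. *)
  rewrite -[RHS]/(0%:E) -V0; congr (V _)%:E; apply/seteqP; split=> w //=.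
  rewrite indicE; case: (w \in D); first by rewrite mulr1 (negbTE tv).
  by rewrite mulr0 leNgt t0.
(* For [t <= 0] the level set is everything, so the second integrand vanishes. *)
rewrite [X in (_ + X)%E]integral0_eq ?adde0; last first.
  move=> t /=; rewrite in_itv/= => t0.
  rewrite (_ : [set w | _] = setT) ?V1 ?subrr//.
  by apply/seteqP; split=> w //= _; rewrite (le_trans t0)// mulr_ge0.
have mg : measurable_fun (`]0, +oo[%classic : set R) g.
  exact/measurable_restrict.
have mf : measurable_fun (`]0, +oo[%classic : set R) f :=
  eq_measurable_fun g fg mg.
(* The point 0 is Lebesgue-null, and away from it [f] is [g]. *)
rewrite -integral_itv_obnd_cbnd//.
transitivity (\int[lebesgue_measure]_(t in `]0%R, +oo[) g t)%E.
  by apply/esym/eq_integral => t /fg.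
rewrite -integral_mkcondr setIidr; last first.
  by move=> t /=; rewrite !in_itv/= => /andP[->].
rewrite integral_cst//= EFinM; congr (_ * _)%E.
have /= -> := lebesgue_measure_itv `]0, v].
rewrite lte_fin sube0; case: ltP => // v0'.
(* The case left is [v = 0]: the interval is empty and its length is still [v]. *)
by rewrite (le_anti (introT andP (conj v0' v0))).
Qed.

Theorem proposition3p2 (d : measure_display) (T : measurableType d)
    (R : realType) (V : set T -> R) (X1 X2 : {mfun T >-> R})
    (hV : is_capacity V)
    (hX : fubini_independent V X1 X2 (@measurable _ (borelR2 R))) :
  ((forall f : borelR2 R -> R, measurable_fun setT f ->
      fubini_independent V X1 X2 (upper_level_sets f)) /\
   fubini_independent V X1 X2 (@rectangles R)) /\
  (forall A B : set R, measurable A -> measurable B ->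
     V (X1 @^-1` A `&` X2 @^-1` B) = V (X1 @^-1` A) * V (X2 @^-1` B)).
Proof.
split.
  (* Both families consist of Borel sets, so the hypothesis covers their members. *)
  split=> [f mf _ [a ->]|A rA]; apply: hX; last exact: measurable_rectangles.
  have := mf measurableT `]a, +oo[%classic (measurable_itv _).
  rewrite setTI; congr measurable.
  by apply/seteqP; split=> x /=; rewrite in_itv/= andbT.
move=> A B mA mB.
have mX2B : measurable (X2 @^-1` B) by exact: measurable_sfunP.
have [_ hAB] : _ := hX (A `*` B)
  (@measurable_rectangles R _ (ex_intro _ A (ex_intro _ B (And3 mA mB erefl)))).
apply: EFin_inj; rewrite [LHS]hAB.
case: (hV) => V01 V0 V1 _.
(* The product is turned back into a Choquet integral, which leaves only the integrands to compare;
   the scalar is nonnegative as a capacity value. *)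
rewrite -choquet_scaled_indic//; last by have /andP[] := V01 _ mX2B.
congr choquet; apply/funext => w /=; rewrite indicE.
case: (boolP (w \in _)) => [/set_mem Aw|/negP nAw].
  rewrite mulr1; congr V; apply/seteqP; split=> w' //=.
  by case.
rewrite mulr0 -V0; congr V; apply/seteqP; split=> w' //= [Aw _].
by apply: nAw; exact: mem_set.
Qed.
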